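(* Let $D$ be a non-negative integer valued random variable with $\mathbb P(D>0)=1$ and $\mathbb E[D]<\infty$, and let $\Delta_\phi$ be the friendship bias of the root of the unimodular branching process tree with root offspring distribution $p_k=\mathbb P\{D=k\}$ (the local limit of the configuration model with limiting degree $D$). Then $$\mathbb E[\Delta_\phi]=\frac{\mathrm{Var}(D)}{\mathbb E[D]}.$$ If moreover $\mathbb E[D^2]<\infty$, then $$\mathbb E[\Delta_\phi^2]=\frac{\big(\mathbb E[D^3]\,\mathbb E[D]-(\mathbb E[D^2])^2\big)\mathbb E[D^{-1}]+\mathbb E[D^2]\,\mathrm{Var}(D)}{(\mathbb E[D])^2}.$$ In particular, $\mathrm{Var}(\Delta_\phi)\ge\mathrm{Var}(D)$. (The value $+\infty$ is allowed on both sides of the identities.)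
   Context: In the unimodular branching process tree with root offspring distribution $p=(p_k)$, $p_k=\mathbb P\{D=k\}$, the root $\phi$ has $d_\phi$ children with $\mathbb P\{d_\phi=k\}=p_k$, and every other vertex independently has a number of children distributed according to $p^\star_k=(k+1)p_{k+1}/\mathbb E[D]$, $k\in\mathbb N_0$. So $d_\phi$ and the numbers $d_1,d_2,\ldots$ of children of the children of the root are independent, $d_\phi\sim p$, and $d_j\sim p^\star$ for all $j$. The friendship bias of the root is $\Delta_\phi=\frac1{d_\phi}\sum_{j=1}^{d_\phi}(d_j+1)-d_\phi$ (note $d_\phi\ge1$ almost surely). The variance inequality is a consequence of the two moment formulas and so refers to the case $\mathbb E[D^2]<\infty$. *)

(* Defs.v *)
From HB Require Import structures.
From mathcomp Require Export all_boot all_order all_algebra.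
From mathcomp Require Export all_classical all_reals all_analysis.

Set Implicit Arguments.
Unset Strict Implicit.
Unset Printing Implicit Defensive.

Import Order.TTheory GRing.Theory Num.Theory.

Local Open Scope classical_set_scope.
Local Open Scope ring_scope.

Definition real_of_nat_fun (R : realType) (T : Type) (N : T -> nat) : T -> R :=
  fun w => (N w)%:R.

Definition mutually_independent (R : realType) (d d' : measure_display)
    (T : measurableType d) (T' : measurableType d') (P : probability T R)
    (I : eqType) (X : I -> T -> T') : Prop :=
  forall (s : seq I) (B : I -> set T'),
    uniq s -> (forall i, measurable (B i)) ->
    P (\big[setI/setT]_(i <- s) (X i @^-1` B i)) =
    (\prod_(i <- s) P (X i @^-1` B i))%E.

Definition offspring_law (R : realType) (d : measure_display)
    (T : measurableType d) (P : probability T R) (D : T -> nat) (k : nat)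
    : \bar R :=
  P (D @^-1` [set k]).

Definition biased_offspring_law (R : realType) (d : measure_display)
    (T : measurableType d) (P : probability T R) (D : T -> nat) (k : nat)
    : \bar R :=
  (k.+1%:R%:E * offspring_law P D k.+1 / 'E_P[real_of_nat_fun R D])%E.

(* Vertices carry Ulam-Harris labels: the root is [::] and the children of v
   are rcons v 0, ..., rcons v (X v w).-1, where X v w is the number of
   children of v.  Offspring numbers are attached to all labels, including
   those that do not occur in the realized tree. *)
Definition unimodular_branching_process (R : realType)
    (d1 d2 : measure_display) (T : measurableType d1) (P : probability T R)
    (D : T -> nat) (Omega : measurableType d2) (Q : probability Omega R)
    (X : seq nat -> {RV Q >-> nat}) : Prop :=
  [/\ mutually_independent Q X,
      forall k, Q (X [::] @^-1` [set k]) = offspring_law P D k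
    & forall v, v != [::] ->
        forall k, Q (X v @^-1` [set k]) = biased_offspring_law P D k].

(* A child of the root has its offspring and the root as neighbours, hence
   degree (c [:: j]).+1. *)
Definition root_friendship_bias (R : realType) (c : seq nat -> nat) : R :=
  (c [::])%:R^-1 * (\sum_(j < c [::]) (c [:: val j]).+1%:R) - (c [::])%:R.

(* Main.v *)
(* On the event [X [::] = n] the bias is [W - n], where [W] is the mean of [n]
   i.i.d. size-biased degrees, independent of the event, with mean
   [m = E[D^2]/E[D]] and variance [v], where [v + m^2 = E[D^3]/E[D]].  Summing
   over [n] gives, for [c >= 0],
     [E[(Delta - c)^2] = v * E[1/D] + E[(D - (m - c))^2]];
   [c = 0] yields the second moment, and [c = E[Delta] = m - E[D]] yields
   [Var(Delta) = v * E[1/D] + Var(D) >= Var(D)].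
   As [v] may be infinite, the second moments are computed through identities
   between non-negative quantities, such as
   [E[(h - a)^2] + 2 a E[h] = E[h^2] + a^2], which need no integrability. *)
Require Import Defs.
From mathcomp Require Import measurable_realfun ring lra.

Import Order.TTheory GRing.Theory Num.Theory.

Set Implicit Arguments.
Unset Strict Implicit.
Unset Printing Implicit Defensive.

Local Open Scope classical_set_scope.
Local Open Scope ring_scope.
Local Open Scope ereal_scope.

(** * Integration over the fibres of a natural-valued random variable *)

Lemma measurable_fun_nat_comp d (T : measurableType d) d' (U : measurableType d')
    (A : set T) (N : T -> nat) (f : nat -> U) :
  measurable_fun setT N -> measurable_fun A (f \o N).
Proof.
move=> mN; apply: measurable_funTS.
exact: measurableT_comp.
Qed.

Section nat_valued.
Context d (T : measurableType d) (R : realType) (P : probability T R).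

Lemma measurable_fiber (N : {RV P >-> nat}) k : measurable (N @^-1` [set k]).
Proof. by rewrite -[X in measurable X]setTI; exact: measurable_funP. Qed.

(** This replaces conditioning on [N]: the fibres form a countable measurable partition of [A], and
    non-negativity makes the splitting valid for infinite integrals too. *)
Lemma ge0_integral_fibers (N : {RV P >-> nat}) (A : set T) (f : T -> \bar R) :
  measurable A -> measurable_fun A f -> (forall x, A x -> 0 <= f x) ->
  \int[P]_(x in A) f x =
  \sum_(k <oo) \int[P]_(x in A `&` N @^-1` [set k]) f x.
Proof.
move=> mA mf f0.
have AE : A = \bigcup_k (A `&` N @^-1` [set k]).
  by apply/seteqP; split=> [x Ax|x [k _ []]//]; exists (N x).
rewrite [in LHS]AE ge0_integral_bigcup//.
- by move=> k; apply: measurableI => //; exact: measurable_fiber.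
- by rewrite -AE.
- by rewrite -AE.
- by move=> i j _ _ [x [[_ <-] [_ <-]]].
Qed.

(** The last hypothesis is independence of [N] from [g] on [A], expressed fibre by fibre, with [G]
    in the role of the integral of [g] over [A]. On a fibre [f (N x)] is a constant and leaves the
    integral. The choice [g = 1], [G = P A] treats one child given the root; [g] a function of a
    second child treats products. *)
Lemma ge0_integral_nat_mulr (N : {RV P >-> nat}) (A : set T) (f : nat -> \bar R)
    (g : T -> \bar R) (G : \bar R) :
  measurable A -> measurable_fun A g -> (forall x, 0 <= g x) ->
  (forall k, 0 <= f k) -> 0 <= G ->
  (forall k, \int[P]_(x in A `&` N @^-1` [set k]) g x =
     P (N @^-1` [set k]) * G) ->
  \int[P]_(x in A) (f (N x) * g x) = (\int[P]_x f (N x)) * G.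
Proof.
move=> mA mg g0 f0 G0 NG.
have mfN B : measurable_fun B (f \o N) by exact: measurable_fun_nat_comp.
rewrite -ge0_integralZr// (ge0_integral_fibers N)//; last 2 first.
- by apply: emeasurable_funM => //; exact: mfN.
- by move=> x _; exact: mule_ge0.
rewrite [RHS](ge0_integral_fibers N)//; last 2 first.
- by apply: emeasurable_funM => //; exact: mfN.
- by move=> x _; exact: mule_ge0.
apply: eq_eseriesr => k _.
have mAk : measurable (A `&` N @^-1` [set k]).
  by apply: measurableI => //; exact: measurable_fiber.
rewrite (eq_integral (fun x => f k * g x)); last first.
  by move=> x /set_mem[_ <-].
rewrite ge0_integralZl//; last exact: measurable_funS mg.
rewrite NG setTI (eq_integral (cst (f k * G))); last first.
  by move=> x /set_mem <-.
by rewrite integral_cst ?muleA 1?(muleAC (f k))//; exact: measurable_fiber.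
Qed.

Lemma ge0_integral_nat (N : {RV P >-> nat}) (f : nat -> \bar R) :
  (forall k, 0 <= f k) ->
  \int[P]_x f (N x) = \sum_(k <oo) f k * P (N @^-1` [set k]).
Proof.
move=> f0; rewrite (ge0_integral_fibers N)//; last exact: measurable_fun_nat_comp.
apply: eq_eseriesr => k _; rewrite setTI (eq_integral (cst (f k))); last first.
  by move=> x /set_mem <-.
by rewrite integral_cst//; exact: measurable_fiber.
Qed.

Lemma ge0_integral_nat_indep (N : {RV P >-> nat}) (A : set T) (f : nat -> \bar R) :
  measurable A -> (forall k, 0 <= f k) ->
  (forall k, P (A `&` N @^-1` [set k]) = P (N @^-1` [set k]) * P A) ->
  \int[P]_(x in A) f (N x) = (\int[P]_x f (N x)) * P A.
Proof.
move=> mA f0 NA; rewrite -(@ge0_integral_nat_mulr N A f (cst 1))//.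
  by apply: eq_integral => x _; rewrite mule1.
move=> k; rewrite integral_cst ?mul1e; first exact: NA.
by apply: measurableI => //; exact: measurable_fiber.
Qed.

Lemma ge0_le_integral_pos_nat (N : {RV P >-> nat}) (f g : nat -> \bar R) :
  P (N @^-1` [set 0%N]) = 0 -> (forall k, 0 <= f k) -> (forall k, 0 <= g k) ->
  (forall k, (0 < k)%N -> f k <= g k) ->
  \int[P]_x f (N x) <= \int[P]_x g (N x).
Proof.
move=> N0 f0 g0 fg; rewrite !ge0_integral_nat//; apply: lee_nneseries.
  by move=> k _ _; exact: mule_ge0.
case=> [|k] _; first by rewrite N0 !mule0.
by rewrite lee_wpmul2r// fg.
Qed.

Lemma ge0_integral_sqr_dev (A : set T) (h : T -> R) (a : R) :
  measurable A -> measurable_fun A h -> (forall x, A x -> (0 <= h x)%R) ->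
  (0 <= a)%R ->
  \int[P]_(x in A) ((h x - a) ^+ 2)%:E + (2 * a)%:E * \int[P]_(x in A) (h x)%:E =
  \int[P]_(x in A) ((h x) ^+ 2)%:E + (a ^+ 2)%:E * P A.
Proof.
move=> mA mh h0 a0.
rewrite -integral_cst// -ge0_integralZl//; first last.
- by rewrite lee_fin mulr_ge0.
- exact/measurable_EFinP.
rewrite -!ge0_integralD//.
- apply: eq_integral => x _; rewrite /= -EFinM -!EFinD; congr (_%:E).
  by rewrite sqrrB -mulr_natl; ring.
- by move=> x _; rewrite lee_fin sqr_ge0.
- by apply/measurable_EFinP; exact: measurable_funX.
- by move=> x _; rewrite lee_fin sqr_ge0.
- by move=> x _; rewrite lee_fin sqr_ge0.
- by apply/measurable_EFinP; apply: measurable_funX; exact: measurable_funB.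
- by move=> x Ax; rewrite mule_ge0// lee_fin ?mulr_ge0 ?h0.
- by apply: measurable_funeM; exact/measurable_EFinP.
Qed.

(** Here [f] may have infinite integral. Since [f >= 0], the negative part [n] of [f - g] is at most
    [g], so its integral is finite. With [p] the positive part, [p + g = f + n] relates non-negative
    functions; it is integrated termwise, and the two finite integrals are then subtracted. *)
Lemma integralB_fin_numr (f g : T -> R) :
  measurable_fun setT f -> measurable_fun setT g ->
  (forall x, 0 <= f x)%R -> (forall x, 0 <= g x)%R ->
  \int[P]_x (g x)%:E < +oo ->
  \int[P]_x (f x - g x)%:E = \int[P]_x (f x)%:E - \int[P]_x (g x)%:E.
Proof.
move=> mf mg f0 g0 goo.
have mfg : measurable_fun setT (fun x => (f x - g x)%:E).
  by apply/measurable_EFinP; exact: measurable_funB.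
rewrite integralE.
set p := (fun x => (f x - g x)%:E)^\+; set n := (fun x => (f x - g x)%:E)^\-.
have mp : measurable_fun setT p by exact: measurable_funepos.
have mn : measurable_fun setT n by exact: measurable_funeneg.
have n_le : \int[P]_x n x <= \int[P]_x (g x)%:E.
  apply: ge0_le_integral => //.
  - by move=> x _; exact: funeneg_ge0.
  - exact/measurable_EFinP.
  - move=> x _; rewrite /n funenegE -EFinN -EFin_max lee_fin ge_max g0 andbT.
    by rewrite opprB gerBl.
have n_ge0 : 0 <= \int[P]_x n x by apply: integral_ge0 => x _; exact: funeneg_ge0.
have g_ge0 : 0 <= \int[P]_x (g x)%:E by apply: integral_ge0 => x _; rewrite lee_fin.
have pgfn : \int[P]_x p x + \int[P]_x (g x)%:E =
    \int[P]_x (f x)%:E + \int[P]_x n x.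
  rewrite -!ge0_integralD//; try by [exact/measurable_EFinP
    | move=> x _; rewrite ?funeneg_ge0 ?funepos_ge0 ?lee_fin].
  apply: eq_integral => x _; rewrite /p /n funeposE funenegE.
  rewrite -EFinN -!EFin_max -!EFinD; congr (_%:E).
  by rewrite /Num.max; case: ifPn; case: ifPn; lra.
have nfin : \int[P]_x n x \is a fin_num by rewrite ge0_fin_numE// (le_lt_trans n_le).
have gfin : \int[P]_x (g x)%:E \is a fin_num by rewrite ge0_fin_numE.
move: pgfn => /(congr1 (fun z => z - \int[P]_x (g x)%:E - \int[P]_x n x)).
rewrite addeK// => ->.
by rewrite addeAC addeK.
Qed.

End nat_valued.

Lemma sume_const_ord (R : realType) n (x : \bar R) :
  \sum_(i < n) x = n%:R%:E * x.
Proof. by rewrite big_const_ord iter_addr_0 mule_natl. Qed.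

(** Needed because the bias is a sum with a random number of terms; on a fibre of the root's
    offspring number the length is fixed. *)
Lemma measurable_fun_fibers d (T : measurableType d) d' (U : measurableType d')
    (R : realType) (P : probability T R) (N : {RV P >-> nat}) (f : T -> U) :
  (forall k, measurable_fun (N @^-1` [set k]) f) -> measurable_fun setT f.
Proof.
move=> mf; have -> : setT = \bigcup_k (N @^-1` [set k]).
  by apply/seteqP; split=> // x _; exists (N x).
by apply/measurable_fun_bigcup => // k; exact: measurable_fiber.
Qed.

(** * Offspring laws of the root and of its children *)

Section tree.
Context d1 d2 (R : realType) (T : measurableType d1) (P : probability T R)
  (N : {RV P >-> nat}) (Omega : measurableType d2) (Q : probability Omega R)
  (X : seq nat -> {RV Q >-> nat}).
Context (bpX : unimodular_branching_process P N X).

Lemma ge0_integral_offspring_root (f : nat -> \bar R) : (forall k, 0 <= f k) ->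
  \int[Q]_w f (X [::] w) = \int[P]_x f (N x).
Proof.
move=> f0; case: bpX => _ rootX _; rewrite !ge0_integral_nat//.
by apply: eq_eseriesr => k _; rewrite rootX.
Qed.

(** The degree [(X v w).+1] takes the value [k+1] with probability [(k+1) p_(k+1) / e1], which is
    the size-biased law of [N]. *)
Lemma ge0_integral_offspring_child (e1 : R) (f : nat -> \bar R) v :
  \int[P]_x (N x)%:R%:E = e1%:E -> (0 < e1)%R -> (forall k, 0 <= f k) ->
  v != [::] ->
  \int[Q]_w f (X v w).+1 = (e1^-1)%:E * \int[P]_x (f (N x) * (N x)%:R%:E).
Proof.
move=> Ee1 e1_gt0 f0 vN0; case: bpX => _ _ /(_ v vN0) childX.
have fN0 k : 0 <= f k * k%:R%:E by rewrite mule_ge0// lee_fin.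
rewrite (ge0_integral_nat (X v) (fun k => f0 k.+1)).
rewrite (ge0_integral_nat N fN0).
(* The factor [k] kills the term at [0], so the shift from offspring number to degree loses
   nothing. *)
rewrite [in RHS]nneseries_recl//; last by move=> k _; rewrite mule_ge0.
rewrite mule0 mul0e add0e -[in RHS]nneseries_addn; last first.
  by move=> k; rewrite mule_ge0.
rewrite -nneseriesZl; last by move=> k _; rewrite mule_ge0.
apply: eq_eseriesr => k _; rewrite childX /biased_offspring_law /offspring_law.
rewrite unlock Ee1 inver gt_eqF// addn1.
by rewrite !muleA muleC !muleA.
Qed.

(** * Independence of the root and its children *)

Let A n := X [::] @^-1` [set n].

Lemma measurable_root_fiber n : measurable (A n).
Proof. exact: measurable_fiber. Qed.

Lemma indep_root_child n v k : v != [::] ->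
  Q (A n `&` X v @^-1` [set k]) = Q (X v @^-1` [set k]) * Q (A n).
Proof.
move=> vN0; case: bpX => indX _ _.
have := indX [:: [::]; v]
  (fun i => if i == [::] then [set n] else [set k]).
rewrite /= inE eq_sym vN0 => /(_ isT) /=.
rewrite !big_cons !big_nil /= (negbTE vN0) setIT mule1 muleC; apply=> i.
by case: ifP.
Qed.

Lemma indep_root_children n u v k l : u != [::] -> v != [::] -> u != v ->
  Q ((A n `&` X u @^-1` [set k]) `&` X v @^-1` [set l]) =
  Q (X v @^-1` [set l]) * Q (A n `&` X u @^-1` [set k]).
Proof.
move=> uN0 vN0 uv; rewrite indep_root_child//; case: bpX => indX _ _.
have := indX [:: [::]; u; v] (fun i =>
  if i == [::] then [set n] else if i == u then [set k] else [set l]).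
rewrite /= !inE ![[::] == _]eq_sym (negbTE vN0) (negbTE uN0) uv => /(_ isT) /=.
rewrite !big_cons !big_nil /= ?eqxx (negbTE vN0) (negbTE uN0) eq_sym (negbTE uv).
rewrite setIT mule1 setIA => ->//.
by rewrite muleA muleC (muleC (Q (A n))).
Qed.

Lemma ge0_integral_root_child n v (f : nat -> \bar R) :
  v != [::] -> (forall k, 0 <= f k) ->
  \int[Q]_(w in A n) f (X v w) = (\int[Q]_w f (X v w)) * Q (A n).
Proof.
move=> vN0 f0; apply: ge0_integral_nat_indep => //.
  exact: measurable_root_fiber.
by move=> k; exact: indep_root_child.
Qed.

Lemma ge0_integral_root_children n u v (f g : nat -> \bar R) :
  u != [::] -> v != [::] -> u != v ->
  (forall k, 0 <= f k) -> (forall k, 0 <= g k) ->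
  \int[Q]_(w in A n) (f (X u w) * g (X v w)) =
  (\int[Q]_w f (X u w)) * ((\int[Q]_w g (X v w)) * Q (A n)).
Proof.
move=> uN0 vN0 uv f0 g0.
apply: (@ge0_integral_nat_mulr _ _ _ _ (X u) _ f (fun w => g (X v w))) => //.
- exact: measurable_root_fiber.
- by apply: (@measurable_fun_nat_comp _ _ _ _ _ (X v) g).
- by rewrite mule_ge0// integral_ge0.
- move=> k; rewrite ge0_integral_nat_indep//.
  + by rewrite indep_root_child// muleCA.
  + by apply: measurableI; exact: measurable_fiber.
  + by move=> l; exact: indep_root_children.
Qed.

(** * Moments of the mean child degree on a root fibre *)

Let Y j w : R := (X [:: j] w).+1%:R.
(** The length [n] is deterministic; [W n] agrees with the average occurring in the bias only on the
    event [A n]. *)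
Let W n w : R := (n%:R^-1 * \sum_(j < n) Y j w)%R.

Lemma measurable_child_degree j B : measurable_fun B (Y j).
Proof.
by apply: (@measurable_fun_nat_comp _ _ _ _ B (X [:: j]) (fun k => k.+1%:R : R)).
Qed.

Lemma measurable_mean_child_degree n B : measurable_fun B (W n).
Proof.
apply: measurable_funM => //; apply: measurable_sum => j.
exact: measurable_child_degree.
Qed.

Lemma mean_child_degree_ge0 n w : (0 <= W n w)%R.
Proof. by rewrite mulr_ge0// sumr_ge0. Qed.

(** Each of the [n] terms contributes [M * Q (A n)] by independence from the root, and the factor
    [1/n] cancels their number. [M] is extended real because [E[D^2]] may be infinite. *)
Lemma integral_mean_child_degree (M : \bar R) n :
  (forall j, \int[Q]_w (Y j w)%:E = M) -> (0 < n)%N ->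
  \int[Q]_(w in A n) (W n w)%:E = M * Q (A n).
Proof.
move=> EY n_gt0.
have nV0 : (0 <= n%:R^-1 :> R)%R by rewrite invr_ge0.
under eq_integral do rewrite EFinM -sumEFin.
rewrite ge0_integralZl//.
- rewrite ge0_integral_sum//.
  + under eq_bigr => j _.
      rewrite (@ge0_integral_root_child n [:: val j] (fun k => k.+1%:R%:E))//.
      rewrite EY; over.
    rewrite sume_const_ord muleA -EFinM mulVf ?mul1e//.
    by rewrite pnatr_eq0 -lt0n.
  + exact: measurable_root_fiber.
  + by move=> j; apply/measurable_EFinP; exact: measurable_child_degree.
  + by move=> j w _; rewrite lee_fin.
- exact: measurable_root_fiber.
- apply: emeasurable_sum => j.
  by apply/measurable_EFinP; exact: measurable_child_degree.
- by move=> w _; rewrite sume_ge0// => j _; rewrite lee_fin.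
Qed.

(** The square is a double sum with factor [1/n^2]. By independence every entry contributes [m^2],
    and each of the [n] diagonal entries an additional [v], which leaves [m^2 + v/n]. Only
    non-negative terms occur, so [v = +oo] is allowed. *)
Lemma integral_mean_child_degree_sqr (m : R) (v : \bar R) n : 0 <= v ->
  (forall j, \int[Q]_w (Y j w)%:E = m%:E) ->
  (forall j, \int[Q]_w ((Y j w) ^+ 2)%:E = v + (m ^+ 2)%:E) -> (0 < n)%N ->
  \int[Q]_(w in A n) ((W n w) ^+ 2)%:E =
  (m ^+ 2)%:E * Q (A n) + v * (n%:R^-1%:E * Q (A n)).
Proof.
move=> v0 EY EY2 n_gt0.
have q0 : 0 <= Q (A n) by [].
have nN0 : (n%:R != 0 :> R)%R by rewrite pnatr_eq0 -lt0n.
have mY j B : measurable_fun B (Y j) by exact: measurable_child_degree.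
have mA := measurable_root_fiber n.
have Eij (i j : 'I_n) : \int[Q]_(w in A n) (Y i w * Y j w)%:E =
    (m ^+ 2)%:E * Q (A n) + (if j == i then v * Q (A n) else 0).
  case: eqP => [->|/eqP ij].
    rewrite (@ge0_integral_root_child n [:: val i]
      (fun k => (k.+1%:R * k.+1%:R)%:E))//.
    by rewrite -ge0_muleDl ?lee_fin ?sqr_ge0// addeC -(EY2 i).
  rewrite adde0; under eq_integral do rewrite EFinM.
  rewrite (@ge0_integral_root_children n [:: val i] [:: val j]
    (fun k => k.+1%:R%:E) (fun k => k.+1%:R%:E))//.
  + by rewrite !EY muleA.
  + by rewrite eqseq_cons andbT eq_sym.
rewrite (eq_integral (fun w => (n%:R^-1 ^+ 2)%:E *
    \sum_(i < n) \sum_(j < n) (Y i w * Y j w)%:E)); last first.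
  move=> w _; rewrite exprMn EFinM; congr (_ * _).
  rewrite expr2 big_distrl -sumEFin; apply: eq_bigr => i _.
  by rewrite big_distrr -sumEFin.
have mYY (i j : 'I_n) : measurable_fun (A n) (fun w => (Y i w * Y j w)%:E).
  by apply/measurable_EFinP; exact: measurable_funM.
have YY0 (i j : 'I_n) w : 0 <= (Y i w * Y j w)%:E by rewrite lee_fin mulr_ge0.
rewrite ge0_integralZl//; last 2 first.
- by apply: emeasurable_sum => i; exact: emeasurable_sum.
- by move=> w _; apply: sume_ge0 => i _; exact: sume_ge0.
rewrite ge0_integral_sum//; last 2 first.
- by move=> i; exact: emeasurable_sum.
- by move=> i w _; exact: sume_ge0.
under eq_bigr => i _.
  rewrite ge0_integral_sum//.
  under eq_bigr do rewrite Eij.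
  (* In each row the conditional term survives only at [j = i]. *)
  rewrite big_split/= -big_mkcond/= big_pred1_eq sume_const_ord.
  over.
rewrite sume_const_ord.
rewrite !ge0_muleDr ?mule_ge0 ?lee_fin ?sqr_ge0//.
rewrite !muleA -!EFinM; congr (_ * _ + _).
  by congr (_%:E); field.
by rewrite (muleC v); congr (_%:E * _ * _); field.
Qed.

(** * Moments of the friendship bias *)

Let Delta w : R := root_friendship_bias R (fun v => X v w).

Lemma root_friendship_bias_fiber n w : A n w -> Delta w = (W n w - n%:R)%R.
Proof. by rewrite /Delta /root_friendship_bias => ->. Qed.

Lemma measurable_root_friendship_bias : measurable_fun setT Delta.
Proof.
apply: (@measurable_fun_fibers _ _ _ _ _ _ (X [::])) => n.
apply: (eq_measurable_fun (fun w => W n w - n%:R)%R).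
  by move=> w /set_mem/root_friendship_bias_fiber ->.
by apply: measurable_funB => //; exact: measurable_mean_child_degree.
Qed.

Context (N_neq0 : P (N @^-1` [set 0%N]) = 0).

Lemma root_fiber0 : Q (A 0%N) = 0.
Proof. by case: bpX => _ -> _. Qed.

(** The mean child degree may have infinite expectation, but the root degree has the finite
    expectation [e1], so the difference may be integrated termwise. On each non-null root fibre the
    mean child degree has the same conditional expectation [M]. *)
Lemma integral_root_friendship_bias (e1 : R) :
  \int[P]_x (N x)%:R%:E = e1%:E -> (0 < e1)%R ->
  \int[Q]_w (Delta w)%:E =
  (e1^-1)%:E * \int[P]_x ((N x)%:R ^+ 2)%:E - e1%:E.
Proof.
move=> Ee1 e1_gt0.
have EY j : \int[Q]_w (Y j w)%:E = (e1^-1)%:E * \int[P]_x ((N x)%:R ^+ 2)%:E.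
  by rewrite (@ge0_integral_offspring_child e1 (fun k => k%:R%:E)).
have EX : \int[Q]_w (X [::] w)%:R%:E = e1%:E.
  by rewrite (@ge0_integral_offspring_root (fun k => k%:R%:E))// => k;
    rewrite lee_fin.
have mWX : measurable_fun setT (fun w => W (X [::] w) w).
  apply: (@measurable_fun_fibers _ _ _ _ _ _ (X [::])) => n.
  apply: (eq_measurable_fun (W n)); last exact: measurable_mean_child_degree.
  by move=> w /set_mem <-.
transitivity (\int[Q]_w (W (X [::] w) w)%:E - \int[Q]_w (X [::] w)%:R%:E).
  apply: integralB_fin_numr => //.
  - by apply: (@measurable_fun_nat_comp _ _ _ _ setT (X [::]) (fun k => k%:R : R)).
  - by move=> w; exact: mean_child_degree_ge0.
  - by rewrite EX ltry.
rewrite EX; congr (_ - _).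
set M := _ * _ in EY *.
have M0 : 0 <= M.
  rewrite mule_ge0//; first by rewrite lee_fin invr_ge0 ltW.
  by apply: integral_ge0 => x _; rewrite lee_fin sqr_ge0.
rewrite (ge0_integral_fibers (X [::]))//; first last.
- by move=> w _; rewrite lee_fin mean_child_degree_ge0.
- exact/measurable_EFinP.
(* [M] is written as the integral of a constant function of the root's offspring number, so that
   both sides become sums over the same fibres. *)
transitivity (\int[Q]_w (cst M (X [::] w))); last first.
  by rewrite integral_cst// [X in _ * X]probability_setT mule1.
rewrite ge0_integral_nat//; apply: eq_eseriesr => n _; rewrite setTI.
rewrite (eq_integral (fun w => (W n w)%:E)); last by move=> w /set_mem <-.
(* For [n = 0] the average is only the default value [0], but that fibre is null and both sides
   vanish. *)
have [->|n_gt0] := posnP n; last exact: integral_mean_child_degree.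
rewrite [X in _ * X]root_fiber0 mule0 null_set_integral//.
- exact: measurable_root_fiber.
- by apply/measurable_EFinP; exact: measurable_mean_child_degree.
- exact: root_fiber0.
Qed.

Lemma integral_root_friendship_bias_sqr_dev (m c : R) (v : \bar R) :
  0 <= v -> (0 <= c)%R ->
  (forall j, \int[Q]_w (Y j w)%:E = m%:E) ->
  (forall j, \int[Q]_w ((Y j w) ^+ 2)%:E = v + (m ^+ 2)%:E) ->
  \int[Q]_w ((Delta w - c) ^+ 2)%:E =
  v * \int[P]_x ((N x)%:R^-1)%:E + \int[P]_x (((N x)%:R - (m - c)) ^+ 2)%:E.
Proof.
move=> v0 c0 EY EY2.
have mD : measurable_fun setT (fun w => ((Delta w - c) ^+ 2)%:E).
  apply/measurable_EFinP; apply: measurable_funX; apply: measurable_funB => //.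
  exact: measurable_root_friendship_bias.
have mN (f : nat -> \bar R) : measurable_fun setT (f \o N).
  exact: measurable_fun_nat_comp.
(* [f n] is, for [n > 0], the conditional expectation of [(Delta - c)^2] given [n] children of the
   root: the variance [v/n] of the average plus the squared bias of its centre. *)
pose f n : \bar R := v * (n%:R^-1)%:E + ((n%:R - (m - c)) ^+ 2)%:E.
have vV0 n : 0 <= v * (n%:R^-1)%:E by rewrite mule_ge0// lee_fin invr_ge0.
have f0 n : 0 <= f n by rewrite adde_ge0// lee_fin sqr_ge0.
transitivity (\int[P]_x f (N x)); last first.
  rewrite /f ge0_integralD//.
  - by rewrite ge0_integralZl//; exact: (mN (fun n => (n%:R^-1)%:E)).
  - exact: (mN (fun n => v * (n%:R^-1)%:E)).
  - by move=> x _; rewrite lee_fin sqr_ge0.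
  - exact: (mN (fun n => ((n%:R - (m - c)) ^+ 2)%:E)).
rewrite -ge0_integral_offspring_root// (ge0_integral_nat (X [::]) f0).
rewrite (ge0_integral_fibers (X [::]))//; last first.
  by move=> w _; rewrite lee_fin sqr_ge0.
apply: eq_eseriesr => n _; rewrite setTI.
have [->|n_gt0] := posnP n.
  rewrite [X in _ * X]root_fiber0 mule0 null_set_integral//.
  - exact: measurable_root_fiber.
  - exact: measurable_funS mD.
  - exact: root_fiber0.
(* On this fibre [Delta - c] is the deviation of the non-negative [W n] from [n + c]; the assumption
   [c >= 0] makes this centre non-negative, as [ge0_integral_sqr_dev] requires. *)
rewrite (eq_integral (fun w => ((W n w - (n%:R + c)) ^+ 2)%:E)); last first.
  by move=> w /set_mem/root_friendship_bias_fiber ->; rewrite opprD addrA.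
have nc0 : (0 <= n%:R + c)%R by rewrite addr_ge0.
have := @ge0_integral_sqr_dev _ _ _ Q (A n) (W n) _ (measurable_root_fiber n)
  (@measurable_mean_child_degree n _) (fun w _ => mean_child_degree_ge0 n w) nc0.
rewrite (integral_mean_child_degree EY n_gt0).
rewrite (integral_mean_child_degree_sqr v0 EY EY2 n_gt0).
(* Finiteness of the fibre's mass makes the cross term real, so it can be subtracted from both sides
   even when [v] is infinite. *)
have : Q (A n) \is a fin_num by exact: fin_num_measure (measurable_root_fiber n).
rewrite /f -/(A n); case: (Q (A n)) (measure_ge0 Q (A n)) => // q q0 _.
rewrite ge0_muleDl ?lee_fin ?sqr_ge0// muleA -!EFinM.
set x := \int[Q]_(_ in _) _.
move=> /(congr1 (fun z => z - (2 * (n%:R + c) * m * q)%:E)).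
rewrite addeK// => ->; rewrite (addeC _%:E (v * _)) -!addeA -muleA -EFinM.
by congr (_ + _); rewrite -EFinN -!EFinD; congr (_%:E); ring.
Qed.

End tree.

(** * Moments of a positive integer variable and the algebra of the second moment *)

Lemma variance_integralE d (T : measurableType d) (R : realType)
    (P : probability T R) (Z : T -> R) :
  'V_P[Z] = \int[P]_x ((Z x - fine 'E_P[Z]) ^+ 2)%:E.
Proof.
rewrite /variance ![in LHS]unlock; apply: eq_integral => x _.
by rewrite [in RHS]unlock.
Qed.

Section positive.
Context d (T : measurableType d) (R : realType) (P : probability T R)
  (N : {RV P >-> nat}).
Context (N_neq0 : P (N @^-1` [set 0%N]) = 0).

Lemma integral_pos_nat_ge1 : 1 <= \int[P]_x (N x)%:R%:E.
Proof.
have := @ge0_le_integral_pos_nat _ _ _ P N (cst 1) (fun k => k%:R%:E) N_neq0.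
rewrite integral_cst// [X in 1 * X]probability_setT mule1; apply=> // k k0.
by rewrite lee_fin ler1n.
Qed.

Lemma integral_inv_nat_le1 : \int[P]_x ((N x)%:R^-1)%:E <= 1.
Proof.
have := @ge0_le_integral_pos_nat _ _ _ P N (fun k => (k%:R^-1)%:E) (cst 1) N_neq0.
rewrite integral_cst// [X in 1 * X]probability_setT mule1; apply=> // k k0.
by rewrite lee_fin invf_le1 ?ler1n ?ltr0n.
Qed.

(* By AM-GM, [1 / N + N / e1^2 >= 2 / e1]. *)
Lemma integral_inv_nat_ge (e1 : R) : \int[P]_x (N x)%:R%:E = e1%:E ->
  (0 < e1)%R -> (e1^-1)%:E <= \int[P]_x ((N x)%:R^-1)%:E.
Proof.
move=> Ee1 e1_gt0.
have mN (f : nat -> \bar R) : measurable_fun setT (f \o N).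
  exact: measurable_fun_nat_comp.
have e1V0 : (0 <= e1^-1 ^+ 2)%R by rewrite sqr_ge0.
have := @ge0_le_integral_pos_nat _ _ _ P N (cst (2 * e1^-1)%:E)
  (fun k => (k%:R^-1)%:E + (e1^-1 ^+ 2)%:E * k%:R%:E) N_neq0.
rewrite integral_cst// [X in _ * X]probability_setT mule1.
rewrite ge0_integralD//; last 3 first.
- exact: (mN (fun k => (k%:R^-1)%:E)).
- by move=> x _; rewrite mule_ge0// lee_fin.
- exact: (mN (fun k => (e1^-1 ^+ 2)%:E * k%:R%:E)).
rewrite ge0_integralZl//; last exact: (mN (fun k => k%:R%:E)).
rewrite Ee1 -EFinM.
have -> : (e1^-1 ^+ 2 * e1 = e1^-1)%R by field; rewrite gt_eqF.
rewrite -leeBlDr// -EFinB.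
have -> : (2 * e1^-1 - e1^-1 = e1^-1)%R by ring.
apply=> [k|k|k k0].
- by rewrite lee_fin mulr_ge0// invr_ge0 ltW.
- by rewrite adde_ge0// ?mule_ge0// lee_fin ?invr_ge0.
- rewrite -EFinM -EFinD lee_fin.
  have kR0 : (0 < k%:R :> R)%R by rewrite ltr0n.
  rewrite -subr_ge0.
  have -> : (k%:R^-1 + e1^-1 ^+ 2 * k%:R - 2 * e1^-1 =
             k%:R * (k%:R^-1 - e1^-1) ^+ 2)%R.
    by field; rewrite !gt_eqF.
  by rewrite mulr_ge0// sqr_ge0.
Qed.

(** Used with [a = e1] for the variance of [D] and with [a = m] for the second moment of the
    bias. *)
Lemma integral_nat_sqr_dev (e1 a : R) : \int[P]_x (N x)%:R%:E = e1%:E ->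
  (0 <= a)%R ->
  \int[P]_x (((N x)%:R - a) ^+ 2)%:E =
  \int[P]_x ((N x)%:R ^+ 2)%:E + (a ^+ 2 - 2 * a * e1)%:E.
Proof.
move=> Ee1 a0.
have mN : measurable_fun setT (fun x => (N x)%:R : R).
  by apply: (@measurable_fun_nat_comp _ _ _ _ setT N (fun k => k%:R : R)).
have := @ge0_integral_sqr_dev _ _ _ P setT _ a measurableT mN
  (fun _ _ => ler0n _ _) a0.
rewrite Ee1 [X in _ = _ + _ * X]probability_setT mule1 -EFinM.
move=> /(congr1 (fun z => z - (2 * a * e1)%:E)); rewrite addeK// => ->.
by rewrite -addeA -EFinB.
Qed.

End positive.

(** The hypothesis forces [E3] and [v] to be finite together or infinite together. In the finite
    case [v] is eliminated and a field identity remains; in the infinite case both sides are [+oo],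
    because [r] and [e1] are positive. *)
Lemma second_moment_identity (R : realType) (E3 v : \bar R) (e1 e2 r : R) :
  (0 < e1)%R -> (0 < r)%R -> 0 <= E3 -> 0 <= v ->
  (e1^-1)%:E * E3 = v + ((e1^-1 * e2) ^+ 2)%:E ->
  v * r%:E + (e2%:E + ((e1^-1 * e2) ^+ 2 - 2 * (e1^-1 * e2) * e1)%:E) =
  ((E3 * e1%:E - e2%:E ^+ 2) * r%:E + e2%:E * (e2%:E + (- e1 ^+ 2)%:E)) *
  (e1 ^- 2)%:E.
Proof.
move=> e1_gt0 r_gt0; have e1_neq0 : e1 != 0%R by rewrite gt_eqF.
case: E3 => [e3|_|//]; case: v => [s|_|//] //.
- move=> _ _ [E]; have {E}-> : s = (e1^-1 * e3 - (e1^-1 * e2) ^+ 2)%R.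
    by rewrite E addrK.
  by rewrite -EFin_expe -!(EFinM, EFinD, EFinN); congr (_%:E); field.
- by rewrite gt0_muley ?lte_fin ?invr_gt0.
- by rewrite -EFin_expe !(gt0_mulye, addye) ?lte_fin ?invr_gt0 ?exprn_gt0.
Qed.

(** * Assembly of the moment formulas and the variance inequality *)

Theorem theorem4p8 (R : realType) (d1 d2 : measure_display)
    (T : measurableType d1) (P : probability T R) (N : {RV P >-> nat})
    (Omega : measurableType d2) (Q : probability Omega R)
    (X : seq nat -> {RV Q >-> nat}) :
  let D : T -> R := real_of_nat_fun R N in
  let Delta : Omega -> R := fun w => root_friendship_bias R (fun v => X v w) in
  P [set w | (0 < N w)%N] = 1 ->
  'E_P[D] < +oo ->
  unimodular_branching_process P N X ->
  'E_Q[Delta] = 'V_P[D] / 'E_P[D] /\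
  ('E_P[(D ^+ 2)%R] < +oo ->
    'E_Q[(Delta ^+ 2)%R] =
      (('E_P[(D ^+ 3)%R] * 'E_P[D] - 'E_P[(D ^+ 2)%R] ^+ 2)
         * 'E_P[fun w => ((D w)^-1)%R]
       + 'E_P[(D ^+ 2)%R] * 'V_P[D]) / 'E_P[D] ^+ 2
    /\ 'V_P[D] <= 'V_Q[Delta]).
Proof.
move=> D Delta Npos EDoo bpX.
have N_neq0 : P (N @^-1` [set 0%N]) = 0.
  have -> : N @^-1` [set 0%N] = ~` [set w | (0 < N w)%N].
    by apply/seteqP; split=> w /=; [move=> ->|case: (N w)].
  rewrite probability_setC ?Npos ?subee//.
  rewrite (_ : [set w | _] = N @^-1` [set k | (0 < k)%N])//.
  by rewrite -[X in measurable X]setTI; exact: measurable_funP.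
have EDE : 'E_P[D] = \int[P]_x (N x)%:R%:E by rewrite unlock.
have ED2E : 'E_P[(D ^+ 2)%R] = \int[P]_x ((N x)%:R ^+ 2)%:E by rewrite unlock.
have ED3E : 'E_P[(D ^+ 3)%R] = \int[P]_x ((N x)%:R ^+ 3)%:E by rewrite unlock.
have EDVE : 'E_P[fun w => ((D w)^-1)%R] = \int[P]_x ((N x)%:R^-1)%:E.
  by rewrite unlock.
have ED2_ge0 : 0 <= 'E_P[(D ^+ 2)%R].
  by rewrite ED2E integral_ge0// => x _; rewrite lee_fin sqr_ge0.
have ED3_ge0 : 0 <= 'E_P[(D ^+ 3)%R].
  by rewrite ED3E integral_ge0// => x _; rewrite lee_fin exprn_ge0.
have ED_ge1 : 1 <= 'E_P[D] by rewrite EDE; exact: integral_pos_nat_ge1.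
have [e1 ED e1_ge1] : exists2 e1 : R, 'E_P[D] = e1%:E & (1 <= e1)%R.
  by case: ('E_P[D]) ED_ge1 EDoo => // e1; exists e1.
have e1_gt0 : (0 < e1)%R by exact: lt_le_trans e1_ge1.
have e1_neq0 : e1 != 0%R by rewrite gt_eqF.
have Ee1 : \int[P]_x (N x)%:R%:E = e1%:E by rewrite -EDE.
(* This holds without a finite second moment: both sides are then [+oo]. *)
have VD : 'V_P[D] = 'E_P[(D ^+ 2)%R] + (- e1 ^+ 2)%:E.
  rewrite variance_integralE ED [LHS](integral_nat_sqr_dev Ee1 (ltW e1_gt0)).
  by rewrite -ED2E; congr (_ + _%:E); ring.
have EDelta : 'E_Q[Delta] = (e1^-1)%:E * 'E_P[(D ^+ 2)%R] - e1%:E.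
  rewrite [in LHS]unlock ED2E.
  exact: (integral_root_friendship_bias bpX N_neq0 Ee1 e1_gt0).
have EDeltaE : 'E_Q[Delta] = 'V_P[D] / 'E_P[D].
  rewrite EDelta VD ED inver (negbTE e1_neq0).
  rewrite muleDl ?fin_num_adde_defl// (muleC 'E_P[_]) -EFinM.
  by congr (_ + _%:E); field.
split=> // ED2oo.
have [e2 ED2] : exists e2 : R, 'E_P[(D ^+ 2)%R] = e2%:E.
  by case: ('E_P[(D ^+ 2)%R]) ED2_ge0 ED2oo => // e2; exists e2.
have e2_ge0 : (0 <= e2)%R by rewrite -lee_fin -ED2.
have V_ge0 : 0 <= 'V_P[D] by exact: variance_ge0.
(* The upper bound [1] gives finiteness; the lower bound [1/e1] gives strict positivity, which keeps
   [+oo * r] infinite when the third moment is. *)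
have [r EDV r_gt0] : exists2 r : R, 'E_P[fun w => ((D w)^-1)%R] = r%:E & (0 < r)%R.
  have := integral_inv_nat_ge N_neq0 Ee1 e1_gt0.
  have := integral_inv_nat_le1 N_neq0.
  rewrite -EDVE; case: ('E_P[_]) => // r _; rewrite lee_fin => r_ge; exists r => //.
  by rewrite (lt_le_trans _ r_ge)// invr_gt0.
pose m := (e1^-1 * e2)%R.
have m_ge0 : (0 <= m)%R by rewrite mulr_ge0// invr_ge0 ltW.
pose Y j w : R := (X [:: j] w).+1%:R.
have EY j : \int[Q]_w (Y j w)%:E = m%:E.
  rewrite (@ge0_integral_offspring_child _ _ _ _ _ _ _ _ _ bpX e1
    (fun k => k%:R%:E))//.
  by rewrite EFinM -ED2 ED2E.
have EY2 j : \int[Q]_w (Y j w ^+ 2)%:E = (e1^-1)%:E * 'E_P[(D ^+ 3)%R].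
  rewrite (@ge0_integral_offspring_child _ _ _ _ _ _ _ _ _ bpX e1
    (fun k => (k%:R ^+ 2)%:E))//.
  rewrite ED3E; congr (_ * _); apply: eq_integral => x _.
  by rewrite -EFinM -exprSr.
(* Defining [v] as a squared deviation, not as [E[D^3]/E[D] - m^2], makes it visibly non-negative.
   Child [0] serves for all children, since their second moments coincide. *)
pose v := \int[Q]_w ((Y 0%N w - m) ^+ 2)%:E.
have v_ge0 : 0 <= v by apply: integral_ge0 => w _; rewrite lee_fin sqr_ge0.
have vE : (e1^-1)%:E * 'E_P[(D ^+ 3)%R] = v + (m ^+ 2)%:E.
  have mY : measurable_fun setT (Y 0%N) by exact: measurable_child_degree.
  have := @ge0_integral_sqr_dev _ _ _ Q setT _ m measurableT mY
    (fun _ _ => ler0n _ _) m_ge0.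
  rewrite EY EY2 [X in _ = _ + _ * X]probability_setT mule1 -/v -EFinM.
  move=> /(congr1 (fun z => z - (m ^+ 2)%:E)); rewrite addeK// => <-.
  by rewrite -addeA -EFinB; congr (_ + _%:E); ring.
have Y2E j : \int[Q]_w (Y j w ^+ 2)%:E = v + (m ^+ 2)%:E by rewrite EY2.
have dev c (c0 : (0 <= c)%R) :=
  integral_root_friendship_bias_sqr_dev bpX N_neq0 v_ge0 c0 EY Y2E.
split.
  have -> : 'E_Q[(Delta ^+ 2)%R] = \int[Q]_w ((Delta w - 0) ^+ 2)%:E.
    by rewrite unlock; apply: eq_integral => w _; rewrite subr0.
  rewrite dev// subr0 (integral_nat_sqr_dev Ee1 m_ge0) -EDVE -ED2E.
  rewrite EDV ED2 VD ED2 ED.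
  have -> : (e1%:E ^+ 2)^-1 = (e1 ^- 2)%:E.
    by rewrite -EFin_expe inver expf_eq0/= (negbTE e1_neq0).
  exact: second_moment_identity vE.
(* The mean [m - e1] of the bias is an admissible centre [c], because [e1 * (m - e1) = E[D^2] - e1^2
   = Var(D) >= 0]. *)
have mu_ge0 : (0 <= m - e1)%R.
  rewrite -(pmulr_rge0 _ e1_gt0) mulrBr mulVKf// -expr2 -lee_fin EFinD.
  by rewrite -ED2 -VD.
rewrite [leRHS]variance_integralE EDelta ED2 -EFinM -EFinB /= -/m dev//.
(* With this centre the root term is the squared deviation of [D] from its own mean, so what exceeds
   [Var(D)] is the non-negative [v * E[1/D]]. *)
have -> : (m - (m - e1) = e1)%R by ring.
rewrite variance_integralE ED leeDr// mule_ge0//.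
by rewrite -EDVE EDV lee_fin ltW.
Qed.
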